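(* (Analog model.) Let $M\le N$ be positive integers, let $\mathbf{A}\in\mathbb{C}^{M\times N}$ be the sampling matrix of the analog model, and let $\mathbf{\Phi}=\bar{\mathbf{A}}\odot\mathbf{A}\in\mathbb{C}^{M^2\times N}$. If $\mathbf{A}$ is full spark, $M^2\ge N$ and $2M>N$, then for every $f\in\mathcal{F}_s$ the linear system $\mathbf{r_z}(f)=\mathbf{\Phi}\,\mathbf{r_x}(f)$ in the unknown $\mathbf{r_x}(f)\in\mathbb{C}^N$ has a unique solution. (Digital model.) Let $M< N$ be positive integers, let $\mathbf{A}\in\mathbb{C}^{M\times N}$ be the sampling matrix of the digital model, let $\mathbf{F}$ be the $N\times N$ DFT matrix, $\mathbf{G}=\frac1N\mathbf{A}\mathbf{F}^H$ and $\mathbf{\Phi}=\bar{\mathbf{G}}\odot\mathbf{G}\in\mathbb{C}^{M^2\times N}$. If $\mathbf{A}\mathbf{F}^H$ is full spark, $M^2\ge N$ and $2M>N$, then the linear system $\mathbf{r_z}=\mathbf{\Phi}\,\mathbf{r_c}$ in the unknown $\mathbf{r_c}\in\mathbb{C}^N$ has a unique solution.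
   Context: An $M\times N$ matrix with $M\le N$ is full spark if every $M$ of its columns are linearly independent. $\bar{\mathbf{T}}$ is the entrywise complex conjugate of $\mathbf{T}$, $(\cdot)^H$ the conjugate transpose, $\otimes$ the Kronecker product. The Khatri–Rao product $\bar{\mathbf{T}}\odot\mathbf{T}$ is the $M^2\times N$ matrix whose $j$th column is $\bar{\mathbf{t}}_j\otimes\mathbf{t}_j$, where $\mathbf{t}_j$ is the $j$th column of $\mathbf{T}$. $\text{vec}$ stacks the columns of a matrix. Analog model. $\mathcal{F}_s=[-f_s/2,f_s/2]$ is a frequency interval. For each $f\in\mathcal{F}_s$ the vector of sample spectra is $\mathbf{z}(f)=\mathbf{A}\mathbf{x}(f)$, where $\mathbf{x}(f)\in\mathbb{C}^N$ contains the $N$ spectral bins (frequency slices of length $f_s$) of a wide-sense stationary signal. By stationarity, the autocorrelation matrix $\mathbf{R_x}(f)=\mathbb{E}[\mathbf{x}(f)\mathbf{x}^H(f)]$ is diagonal; its diagonal, written as a vector, is $\mathbf{r_x}(f)\in\mathbb{C}^N$ (the power spectrum values on the bins). The measured data are $\mathbf{R_z}(f)=\mathbb{E}[\mathbf{z}(f)\mathbf{z}^H(f)]=\mathbf{A}\mathbf{R_x}(f)\mathbf{A}^H$ and $\mathbf{r_z}(f)=\text{vec}(\mathbf{R_z}(f))=(\bar{\mathbf{A}}\otimes\mathbf{A})\,\text{vec}(\mathbf{R_x}(f))=\mathbf{\Phi}\,\mathbf{r_x}(f)$. Digital model. $\mathbf{z}=\mathbf{A}\mathbf{x}$, where $\mathbf{x}$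 is the vector of $N$ Nyquist samples of the signal, $\mathbf{x}=\frac1N\mathbf{F}^H\mathbf{c}$ with $\mathbf{c}$ the vector of Fourier coefficients, so $\mathbf{z}=\mathbf{G}\mathbf{c}$. By stationarity, $\mathbf{R_c}=\mathbb{E}[\mathbf{c}\mathbf{c}^H]$ is diagonal, with diagonal vector $\mathbf{r_c}\in\mathbb{C}^N$. The measured data are $\mathbf{R_z}=\mathbb{E}[\mathbf{z}\mathbf{z}^H]=\mathbf{G}\mathbf{R_c}\mathbf{G}^H$ and $\mathbf{r_z}=\text{vec}(\mathbf{R_z})=\mathbf{\Phi}\,\mathbf{r_c}$. In both models the data vector on the left-hand side of the system arises from an actual signal, so it lies in the range of $\mathbf{\Phi}$. *)

(* Defs.v *)
From mathcomp Require Import all_boot all_order all_algebra.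
From mathcomp Require Import all_classical all_reals all_analysis.
From mathcomp Require Import complex mxtens.

Set Implicit Arguments.
Unset Strict Implicit.
Unset Printing Implicit Defensive.

Import Order.TTheory GRing.Theory Num.Theory.
Local Open Scope ring_scope.
Local Open Scope complex_scope.

Section Matrices.
Variable C : numClosedFieldType.

Definition mxconj m n (A : 'M[C]_(m, n)) : 'M[C]_(m, n) := map_mx Num.conj A.

Definition mxadj m n (A : 'M[C]_(m, n)) : 'M[C]_(n, m) := (mxconj A)^T.

Definition full_spark m n (A : 'M[C]_(m, n)) : Prop :=
  forall S : {set 'I_n}, #|S| = m -> free [seq col j A | j in S].

(* The column type ['M_(m * p, 1 * 1)] of a Kronecker product of two columns is
   convertible to ['cV_(m * p)]. *)
Definition khatri_rao m p n (A : 'M[C]_(m, n)) (B : 'M[C]_(p, n)) :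
    'M[C]_(m * p, n) :=
  \matrix_(k, j) (tensmx (col j A) (col j B) : 'cV[C]_(m * p)) k 0.

(* [mxvec] concatenates rows, hence the transposes; see [vecE]. *)
Definition vec m n (A : 'M[C]_(m, n)) : 'cV[C]_(n * m) := (mxvec A^T)^T.

End Matrices.

Section Random.
Context {d : measure_display} {T : measurableType d} {R : realType}.
Variable P : probability T R.

(* Meaningful for integrable real and imaginary parts: [fine] maps infinities to
   0. The products in [autocorr] are integrable for square integrable vectors. *)
Definition cexpectation (Z : T -> R[i]) : R[i] :=
  fine ('E_P[fun t => complex.Re (Z t)])%E
  +i* fine ('E_P[fun t => complex.Im (Z t)])%E.

Definition square_integrable n (X : T -> 'cV[R[i]]_n) : Prop :=
  forall k : 'I_n,
    ((fun t => complex.Re (X t k 0)) \in Lfun P 2%:E) /\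
    ((fun t => complex.Im (X t k 0)) \in Lfun P 2%:E).

Definition autocorr n (X : T -> 'cV[R[i]]_n) : 'M[R[i]]_n :=
  \matrix_(k, l) cexpectation (fun t => (X t *m mxadj (X t)) k l).

End Random.

(* Unnormalised: the entry (k, l) is exp(- 2 pi i k l / n). *)
Definition dft (R : realType) n : 'M[R[i]]_n :=
  \matrix_(k, l) (cos (2 * pi * (k * l)%N%:R / n%:R)
                  -i* sin (2 * pi * (k * l)%N%:R / n%:R)).

Lemma index_allpairs_pair (S U : eqType) (s : seq S) (u : seq U) a b :
  a \in s -> b \in u ->
  index (a, b) [seq (v, w) | v <- s, w <- u] =
    (index a s * size u + index b u)%N.
Proof.
elim: s => [//|a' s IHs]; rewrite inE => a_s b_u.
rewrite allpairs_cons index_cat /= size_map.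
have inj_a' : injective (pair a' : U -> S * U) by move=> ? ? [].
have [aa'|a'a] := eqVneq a' a.
  by rewrite -aa' (mem_map inj_a') b_u mul0n add0n (index_map inj_a').
case: mapP => [[w _ [aa' _]]|_]; first by rewrite aa' eqxx in a'a.
rewrite IHs //; last by case/orP: a_s => // /eqP e; rewrite e eqxx in a'a.
by rewrite mulSn addnA.
Qed.

Lemma val_enum_rank_pair m n (i : 'I_m) (j : 'I_n) :
  enum_rank (i, j) = (i * n + j)%N :> nat.
Proof.
have -> : enum_rank (i, j) = index (i, j) (enum {: 'I_m * 'I_n}) :> nat.
  rewrite -[in RHS](nth_enum_rank (i, j) (i, j)) index_uniq ?enum_uniq //.
  by rewrite -cardE.
rewrite enumT unlock /= /prod_enum index_allpairs_pair ?mem_enum //.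
by rewrite !index_enum_ord size_enum_ord.
Qed.

Lemma vecE (C : numClosedFieldType) m n (A : 'M[C]_(m, n)) i j :
  vec A (mxtens_index (j, i)) 0 = A i j.
Proof.
rewrite /vec mxE.
have -> : mxtens_index (j, i) = mxvec_index j i.
  by apply: val_inj; rewrite /= val_enum_rank_pair.
by rewrite mxvecE mxE.
Qed.

(* Main.v *)
Require Import Defs.
From mathcomp Require Import all_boot all_order all_algebra.
From mathcomp Require Import all_classical all_reals all_analysis.
From mathcomp Require Import complex mxtens zify.
Import Order.TTheory GRing.Theory Num.Theory.
Local Open Scope ring_scope.
Local Open Scope complex_scope.

(* By linearity of the expectation [R_z = A R_x A^H] with [R_x] diagonal, so the
   diagonal of [R_x] is a solution.  Since [Phi r = vec (A diag(r) A^H)],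
   uniqueness amounts to [A diag(r) A^H = 0 -> r = 0].  Given a column [j], full
   spark provides a row [w] such that [w A] is [1] at [j] and vanishes on [m - 1]
   other columns; then [w A diag(r) A^H = 0] is a linear relation between at most
   [n - m + 1 <= m] columns of the conjugate of [A], hence trivial, and its
   coefficient at [j] is [r_j]. *)

(** Adjoin [m - #|S|] elements of the complement. This enlarges a small set of columns to the exact
    size that [full_spark] asks for. *)
Lemma exists_superset_card (T : finType) (S : {set T}) m :
  (#|S| <= m <= #|T|)%N -> exists2 S' : {set T}, S \subset S' & #|S'| = m.
Proof.
move=> /andP[leSm lemT].
have: (m - #|S| <= #|~: S|)%N by rewrite [#|~: S|]cardsCs finset.setCK leq_sub2r.
case/card_geqP=> s [s_uniq s_size sC].
exists (S :|: [set x in s]); first exact: finset.subsetUl.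
have /eqP dSs : S :&: [set x in s] == finset.set0.
  rewrite finset.setI_eq0 finset.disjoints_subset; apply/fintype.subsetP => x xS.
  by rewrite !inE; apply: contraL xS => /sC; rewrite inE.
by rewrite cardsU dSs cards0 subn0 cardsE (card_uniqP s_uniq) s_size subnKC.
Qed.

(** * Linear algebra of full spark matrices *)

Section FullSpark.
Variables (C : numClosedFieldType) (m n : nat) (A : 'M[C]_(m, n)).
Hypothesis sparkA : full_spark A.

(** [A *m v] is a linear combination of the columns indexed by [S] alone, and these are
    independent. *)
Lemma full_spark_eq0 (S : {set 'I_n}) (v : 'cV[C]_n) :
  #|S| = m -> (forall j, j \notin S -> v j 0 = 0) -> A *m v = 0 -> v = 0.
Proof.
move=> cardS vS Av0; have /freeP fA := sparkA S cardS.
have vS0 : forall i : 'I_#|S|, v (enum_val i) 0 = 0.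
  apply: (fA (fun i => v (enum_val i) 0)); rewrite -[RHS]Av0.
  under eq_bigr do rewrite nth_image.
  rewrite -(big_enum_val (fun j => v j 0 *: col j A)) /=.
  apply/matrixP => k l; rewrite ord1 summxE mxE [RHS](bigID (mem S)) /=.
  rewrite [X in _ + X]big1 ?addr0 => [|j /vS ->]; last by rewrite mulr0.
  by apply: eq_bigr => j _; rewrite !mxE mulrC.
apply/matrixP => j l; rewrite ord1 mxE.
by have [jS|/vS//] := boolP (j \in S); rewrite -(enum_rankK_in jS jS).
Qed.

(** The submatrix [B] on the columns in [S] is square with independent columns, so its rows span all
    row vectors. *)
Lemma full_spark_interpolation (S : {set 'I_n}) (u : 'rV[C]_n) :
  #|S| = m ->
  exists w : 'rV[C]_m, forall j, j \in S -> (w *m A) 0 j = u 0 j.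
Proof.
move=> cardS; pose B := colsub (enum_val : 'I_#|S| -> 'I_n) A.
have fullB : row_full B.
  (* After transposition, full rank means that [B] kills no nonzero column vector. *)
  rewrite /row_full -mxrank_tr; apply: inj_row_free => v vB0.
  (* Extension of [v] by zero outside [S], so that [full_spark_eq0] applies. *)
  pose v' : 'cV[C]_n := \col_j
    if [pick i : 'I_#|S| | enum_val i == j] is Some i then v 0 i else 0.
  have v'E i : v' (enum_val i) 0 = v 0 i.
    rewrite mxE; case: pickP => [k /eqP /enum_val_inj -> //|/(_ i)].
    by rewrite eqxx.
  suff v'0 : v' = 0.
    by apply/matrixP => k i; rewrite ord1 -v'E v'0 !mxE.
  apply: (full_spark_eq0 S) => // [j jS|].
    rewrite mxE; case: pickP => // i /eqP ij.
    by rewrite -ij enum_valP in jS.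
  apply/matrixP => k l; rewrite ord1 mxE (bigID (mem S)) /=.
  rewrite [X in _ + X]big1 ?addr0 => [|j jS]; last first.
    rewrite [v' _ _]mxE; case: pickP => [i /eqP ij|]; last by rewrite mulr0.
    by rewrite -ij enum_valP in jS.
  rewrite big_enum_val /=.
  transitivity ((v *m B^T) 0 k); last by rewrite vB0 !mxE.
  by rewrite [RHS]mxE; apply: eq_bigr => i _; rewrite v'E !mxE mulrC.
have [w uw] : exists w, colsub (enum_val : 'I_#|S| -> 'I_n) u = w *m B.
  by apply/submxP; exact: submx_full.
exists w => j jS; have /matrixP/(_ 0 (enum_rank_in jS j)) := uw.
rewrite !mxE enum_rankK_in // => ->.
by apply: eq_bigr => i _; rewrite mxE enum_rankK_in.
Qed.

Lemma full_spark_gram_eq0 (r : 'cV[C]_n) :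
  (m <= n)%N -> (n < 2 * m)%N -> A *m diag_mx r^T *m mxadj A = 0 -> r = 0.
Proof.
move=> lemn ltn2m Ar0; apply/matrixP => j0 l; rewrite ord1 [RHS]mxE.
have m_gt0 : (0 < m)%N by case: (m) ltn2m.
have [|S j0S cardS] := exists_superset_card _ [set j0] m.
  by rewrite cards1 m_gt0 card_ord.
rewrite finset.sub1set in j0S.
have [w wA] := full_spark_interpolation S (delta_mx 0 j0) cardS.
(* Outside [S :\ j0] there are [n - m + 1] columns, and [n < 2 * m] bounds this by [m]. *)
have [|S' sS' cardS'] := exists_superset_card _ (~: (S :\ j0)) m.
  have := cardsC (S :\ j0); have := cardsD1 j0 S.
  rewrite j0S cardS !card_ord lemn andbT; lia.
(* The relation obtained from [w] concerns the columns of the conjugate of [A]; conjugating the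
   coefficients turns it into [A *m v = 0]. *)
pose v : 'cV[C]_n := \col_j Num.conj ((w *m A) 0 j * r j 0).
have v0 : v = 0.
  apply: (full_spark_eq0 S') => // [j|].
    move=> jS'; have : j \notin ~: (S :\ j0).
      by apply: contra jS'; exact: (fintype.subsetP sS').
    rewrite !inE negbK => /andP[jj0 jS].
    by rewrite mxE wA // mxE (negbTE jj0) andbF mul0r rmorph0.
  have := congr1 (fun B => (mxconj (w *m B))^T) Ar0.
  rewrite mulmx0 /mxconj map_mx0 trmx0 => <-.
  apply/matrixP => k i; rewrite ord1 !mulmxA mul_mx_diag !mxE rmorph_sum /=.
  apply: eq_bigr => j _; rewrite !mxE !rmorphM /= conjCK.
  by rewrite [RHS]mulrC.
have /matrixP/(_ j0 0) := v0.
rewrite mxE wA // !mxE !eqxx mul1r => /eqP.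
by rewrite conjC_eq0 => /eqP.
Qed.

End FullSpark.

(** * Vectorization and the Khatri-Rao product *)

Lemma vec_inj (C : numClosedFieldType) m n : injective (@vec C m n).
Proof.
by move=> A B AB; apply/matrixP => i j; rewrite -[LHS]vecE -[RHS]vecE AB.
Qed.

(** At index [(i, j)] both sides are the sum over [p] of [Num.conj (A i p) * A j p * r p 0]. Since
    [vec] stacks columns, the outer index [i] is the column index, which belongs to the conjugated
    factor. *)
Lemma khatri_rao_conj_mul (C : numClosedFieldType) m n (A : 'M[C]_(m, n))
    (r : 'cV[C]_n) :
  khatri_rao (mxconj A) A *m r = vec (A *m diag_mx r^T *m mxadj A).
Proof.
apply/matrixP => k l; rewrite ord1; case: (mxtens_indexP k) => i j.
rewrite vecE !mxE; apply: eq_bigr => p _.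
have colE : (tensmx (col p (mxconj A)) (col p A) : 'cV_(m * m))
    (mxtens_index (i, j)) 0 = Num.conj (A i p) * A j p.
  have := tensmxE (col p (mxconj A)) (col p A) i j 0 0.
  (* The product of two columns has its column index in ['I_(1 * 1)], whose only element is [0]. *)
  by rewrite [mxtens_index (0, 0)](_ : _ = 0) ?mxE //; exact: val_inj.
by rewrite mxE colE mul_mx_diag !mxE -mulrA mulrC.
Qed.

(** Carries full spark from [A *m mxadj F] to [G] in the digital model. *)
Lemma full_sparkZ (C : numClosedFieldType) m n (A : 'M[C]_(m, n)) a :
  a != 0 -> full_spark A -> full_spark (a *: A).
Proof.
move=> a0 sparkA S cardS; apply/freeP => k k0.
have /freeP fA := sparkA S cardS.
apply: (fA k); apply: (scalerI a0).
rewrite scaler0 -[RHS]k0 scaler_sumr; apply: eq_bigr => i _ /=.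
rewrite !nth_image; apply/matrixP => p q.
by rewrite !mxE mulrCA.
Qed.

(** * Complex expectation, autocorrelation and the resulting linear system *)

Section Expectation.
Context {d : measure_display} {T : measurableType d} {R : realType}.
Variable P : probability T R.

(** Under this condition both expectations in [cexpectation] are finite, so [fine] loses nothing. *)
Definition cintegrable (Z : T -> R[i]) : Prop :=
  (fun t => complex.Re (Z t)) \in Lfun P 1 /\
  (fun t => complex.Im (Z t)) \in Lfun P 1.

Let Lfun1D (f g : T -> R) :
  f \in Lfun P 1 -> g \in Lfun P 1 -> (f \+ g) \in Lfun P 1.
Proof. by move=> fL gL; exact: (Lfun_addr_closed P (lexx 1%E)).2. Qed.

Let Lfun1Z (a : R) (f : T -> R) : f \in Lfun P 1 -> (a \o* f) \in Lfun P 1.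
Proof. exact: Lfun_scale. Qed.

Let fine_expectationD (f g : T -> R) : f \in Lfun P 1 -> g \in Lfun P 1 ->
  fine ('E_P[f \+ g])%E = fine ('E_P[f])%E + fine ('E_P[g])%E.
Proof.
by move=> fL gL; rewrite expectationD // fineD // expectation_fin_num.
Qed.

Let fine_expectationZ (a : R) (f : T -> R) : f \in Lfun P 1 ->
  fine ('E_P[a \o* f])%E = a * fine ('E_P[f])%E.
Proof.
by move=> fL; rewrite expectationZl // fineM // expectation_fin_num.
Qed.

Let ReD (Z W : T -> R[i]) : (fun t => complex.Re (Z t + W t)) =
  (fun t => complex.Re (Z t)) \+ (fun t => complex.Re (W t)).
Proof. by apply/funext => t /=; case: (Z t) (W t) => ? ? []. Qed.

Let ImD (Z W : T -> R[i]) : (fun t => complex.Im (Z t + W t)) =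
  (fun t => complex.Im (Z t)) \+ (fun t => complex.Im (W t)).
Proof. by apply/funext => t /=; case: (Z t) (W t) => ? ? []. Qed.

Let ReZ (a : R[i]) (Z : T -> R[i]) : (fun t => complex.Re (a * Z t)) =
  (complex.Re a \o* (fun t => complex.Re (Z t))) \+
  (- complex.Im a \o* (fun t => complex.Im (Z t))).
Proof.
apply/funext => t /=; case: a (Z t) => a b [x y] /=.
by rewrite mulrN ![_ * x]mulrC ![_ * y]mulrC.
Qed.

Let ImZ (a : R[i]) (Z : T -> R[i]) : (fun t => complex.Im (a * Z t)) =
  (complex.Re a \o* (fun t => complex.Im (Z t))) \+
  (complex.Im a \o* (fun t => complex.Re (Z t))).
Proof.
apply/funext => t /=; case: a (Z t) => a b [x y] /=.
by rewrite ![_ * x]mulrC ![_ * y]mulrC.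
Qed.

Lemma cintegrableD (Z W : T -> R[i]) :
  cintegrable Z -> cintegrable W -> cintegrable (fun t => Z t + W t).
Proof.
by move=> [? ?] [? ?]; split; [rewrite ReD|rewrite ImD]; exact: Lfun1D.
Qed.

Lemma cintegrableZ (a : R[i]) (Z : T -> R[i]) :
  cintegrable Z -> cintegrable (fun t => a * Z t).
Proof.
move=> [? ?]; split; [rewrite ReZ|rewrite ImZ];
  by apply: Lfun1D; exact: Lfun1Z.
Qed.

Lemma cintegrable0 : cintegrable (fun=> 0).
Proof. by split; exact: (Lfun_addr_closed P (lexx 1%E)).1. Qed.

Lemma cexpectationD (Z W : T -> R[i]) : cintegrable Z -> cintegrable W ->
  cexpectation P (fun t => Z t + W t) = cexpectation P Z + cexpectation P W.
Proof.
by move=> [? ?] [? ?]; rewrite /cexpectation ReD ImD !fine_expectationD.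
Qed.

Lemma cexpectationZ (a : R[i]) (Z : T -> R[i]) : cintegrable Z ->
  cexpectation P (fun t => a * Z t) = a * cexpectation P Z.
Proof.
move=> [? ?]; rewrite /cexpectation ReZ ImZ !fine_expectationD;
  do ?exact: Lfun1Z.
rewrite !fine_expectationZ //; case: a => a b /=.
by apply/eqP; rewrite eq_complex /= mulNr !eqxx.
Qed.

(** Integrability is carried along because additivity needs it at each step of the induction, and
    again for double sums. *)
Lemma cexpectation_sum (I : Type) (s : seq I) (Z : I -> T -> R[i]) :
  (forall i, cintegrable (Z i)) ->
  cintegrable (fun t => \sum_(i <- s) Z i t) /\
  cexpectation P (fun t => \sum_(i <- s) Z i t) =
    \sum_(i <- s) cexpectation P (Z i).
Proof.
move=> Zint; elim: s => [|i s [IHint IHE]].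
  rewrite big_nil; under eq_fun do rewrite big_nil.
  split; first exact: cintegrable0.
  by rewrite /cexpectation !expectation_cst.
rewrite big_cons; under eq_fun do rewrite big_cons.
split; first exact: cintegrableD.
by rewrite cexpectationD // IHE.
Qed.

(** The real and imaginary parts are combinations of products of two square integrable functions,
    which are integrable. *)
Lemma square_integrable_mul_conj n (X : T -> 'cV[R[i]]_n) k l :
  square_integrable P X -> cintegrable (fun t => X t k 0 * Num.conj (X t l 0)).
Proof.
move=> Xsq; have [[Rk Ik] [Rl Il]] := (Xsq k, Xsq l); split.
  have -> : (fun t => complex.Re (X t k 0 * Num.conj (X t l 0))) =
    (fun t => complex.Re (X t k 0)) \* (fun t => complex.Re (X t l 0)) \+
    (fun t => complex.Im (X t k 0)) \* (fun t => complex.Im (X t l 0)).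
    apply/funext => t /=; case: (X t k 0) (X t l 0) => ? ? [? ?] /=.
    by rewrite mulrN opprK.
  by apply: Lfun1D; exact: Lfun2_mul_Lfun1.
have -> : (fun t => complex.Im (X t k 0 * Num.conj (X t l 0))) =
  (fun t => complex.Im (X t k 0)) \* (fun t => complex.Re (X t l 0)) \+
  (-1 \o* ((fun t => complex.Re (X t k 0)) \*
            (fun t => complex.Im (X t l 0)))).
  apply/funext => t /=; case: (X t k 0) (X t l 0) => ? ? [? ?] /=.
  by rewrite mulrN mulrN1 addrC.
by apply: Lfun1D; last apply: Lfun1Z; exact: Lfun2_mul_Lfun1.
Qed.

(** The entries of [(A X) (A X)^H = A (X X^H) A^H] are fixed linear combinations of those of
    [X X^H], so the expectation passes inside. *)
Lemma autocorr_mul m n (A : 'M[R[i]]_(m, n)) (X : T -> 'cV[R[i]]_n) :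
  square_integrable P X ->
  autocorr P (fun t => A *m X t) = A *m autocorr P X *m mxadj A.
Proof.
move=> Xsq; apply/matrixP => k l; rewrite [LHS]mxE [RHS]mxE.
have Xint i j : cintegrable (fun t => (X t *m mxadj (X t)) i j).
  under eq_fun do rewrite mxE big_ord1 !mxE.
  exact: square_integrable_mul_conj.
have -> : (fun t => (A *m X t *m mxadj (A *m X t)) k l) =
  fun t => \sum_j \sum_i
    mxadj A j l * A k i * (X t *m mxadj (X t)) i j.
  apply/funext => t.
  have -> : mxadj (A *m X t) = mxadj (X t) *m mxadj A.
    by rewrite /mxadj /mxconj map_mxM trmx_mul.
  rewrite !mulmxA -(mulmxA A) mxE; apply: eq_bigr => j _.
  by rewrite mxE mulr_suml; apply: eq_bigr => i _; rewrite mulrC mulrA.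
have Xint' i j :
    cintegrable (fun t => mxadj A j l * A k i * (X t *m mxadj (X t)) i j).
  exact: cintegrableZ.
(* The component [.1] gives the integrability of the inner sums required by the outer one. *)
rewrite (cexpectation_sum _ _ _ (fun j => (cexpectation_sum _ _ _ _).1)).2 //.
apply: eq_bigr => j _; rewrite (cexpectation_sum _ _ _ _).2 //.
rewrite [X in _ = X * _]mxE mulr_suml; apply: eq_bigr => i _.
by rewrite cexpectationZ // [in RHS]mxE [RHS]mulrC mulrA.
Qed.

(** Common core of both models: [X] is [x f] in the analog one, and [c], with [G] in place of [A],
    in the digital one. *)
Lemma vec_autocorr_unique_solution m n (A : 'M[R[i]]_(m, n))
    (X : T -> 'cV[R[i]]_n) (Y : T -> 'cV[R[i]]_m) :
  (m <= n)%N -> (n < 2 * m)%N -> full_spark A -> square_integrable P X ->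
  is_diag_mx (autocorr P X) -> (forall t, Y t = A *m X t) ->
  exists! r : 'cV[R[i]]_n,
    vec (autocorr P Y) = khatri_rao (mxconj A) A *m r.
Proof.
move=> lemn ltn2m sparkA Xsq /is_diag_mxP diagX YE.
pose r : 'cV[R[i]]_n := \col_j autocorr P X j j.
have rE : autocorr P X = diag_mx r^T.
  apply/matrixP => i j; rewrite [RHS]mxE; have [<-|ij] := eqVneq i j.
    by rewrite mulr1n !mxE.
  by rewrite mulr0n diagX.
have -> : Y = fun t => A *m X t by apply/funext.
rewrite autocorr_mul // rE -khatri_rao_conj_mul.
exists r; split=> // r' /eqP; rewrite -subr_eq0 -mulmxBr => /eqP Phi0.
apply/eqP; rewrite -subr_eq0; apply/eqP.
apply: (full_spark_gram_eq0 _ _ _ A) => //; apply: vec_inj.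
by rewrite -khatri_rao_conj_mul Phi0 /vec trmx0 linear0 trmx0.
Qed.

End Expectation.

Theorem theorem1 (R : realType) (d : measure_display) (T : measurableType d)
    (P : probability T R) :
  (forall (M N : nat) (A : 'M[R[i]]_(M, N)) (fs : R)
      (x : R -> T -> 'cV[R[i]]_N) (z : R -> T -> 'cV[R[i]]_M),
    (0 < M)%N -> (M <= N)%N -> 0 < fs ->
    (forall f : R, f \in `[- fs / 2, fs / 2] -> square_integrable P (x f)) ->
    (forall f : R, f \in `[- fs / 2, fs / 2] -> is_diag_mx (autocorr P (x f))) ->
    (forall f : R, f \in `[- fs / 2, fs / 2] ->
       forall t : T, z f t = A *m x f t) ->
    let Phi : 'M[R[i]]_(M * M, N) := khatri_rao (mxconj A) A in
    full_spark A -> (N <= M ^ 2)%N -> (N < 2 * M)%N ->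
    forall f : R, f \in `[- fs / 2, fs / 2] ->
      exists! r : 'cV[R[i]]_N, vec (autocorr P (z f)) = Phi *m r)
  /\
  (forall (M N : nat) (A : 'M[R[i]]_(M, N))
      (x c : T -> 'cV[R[i]]_N) (z : T -> 'cV[R[i]]_M),
    (0 < M)%N -> (M < N)%N ->
    let F : 'M[R[i]]_N := dft R N in
    (forall t : T, x t = N%:R^-1 *: (mxadj F *m c t)) ->
    square_integrable P c ->
    is_diag_mx (autocorr P c) ->
    (forall t : T, z t = A *m x t) ->
    let G : 'M[R[i]]_(M, N) := N%:R^-1 *: (A *m mxadj F) in
    let Phi : 'M[R[i]]_(M * M, N) := khatri_rao (mxconj G) G in
    full_spark (A *m mxadj F) -> (N <= M ^ 2)%N -> (N < 2 * M)%N ->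
    exists! r : 'cV[R[i]]_N, vec (autocorr P z) = Phi *m r).
Proof.
split.
  move=> M N A fs x z M_gt0 leMN fs_gt0 xsq diagx zE Phi sparkA _ ltN2M f fF.
  exact: (vec_autocorr_unique_solution _ _ _ _ (x f) _ leMN ltN2M sparkA
    (xsq f fF) (diagx f fF) (zE f fF)).
move=> M N A x c z M_gt0 ltMN F xE csq diagc zE G Phi sparkAF _ ltN2M.
(* Substituting [x] into [z] gives [z t = G *m c t]. *)
apply: (vec_autocorr_unique_solution _ _ _ _ c) => // [||t].
- exact: ltnW.
- apply: full_sparkZ => //.
  by rewrite invr_eq0 pnatr_eq0 -lt0n (leq_ltn_trans _ ltMN).
- by rewrite zE xE -scalemxAl -scalemxAr mulmxA.
Qed.
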